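(* Let $B_m$ be a bouquet of $m\geq 2$ cycles of which exactly $z$ are $4$-cycles. Then $o(B_m)=\mathcal{R}$ if $z\leq 2$, $o(B_m)=\mathcal{N}$ if $z=3$, and $o(B_m)=\mathcal{S}$ if $z\geq 4$. Moreover, if $o(B_m)=\mathcal{R}$ then $R_{\rm MB}(B_m)=R'_{\rm MB}(B_m)=\dim(B_m)$, and if $o(B_m)=\mathcal{S}$ then $S_{\rm MB}(B_m)=S'_{\rm MB}(B_m)=4$.
   Context: A bouquet of $m$ cycles is the graph obtained from $m$ disjoint cycles by identifying one vertex of each cycle into a single common vertex. A resolving set of $G$ is $W\subseteq V(G)$ such that for all distinct $x,y$ some $z\in W$ has $d(x,z)\neq d(y,z)$; $\dim(G)$ is its minimum size. In the Maker-Breaker resolving game, Resolver and Spoiler alternately select (without skipping) a not-yet-selected vertex; Resolver wins if at some point his vertices form a resolving set, otherwise Spoiler wins. R-game: Resolver moves first; S-game: Spoiler moves first. $o=\mathcal{R}$ (resp. $\mathcal{S}$) if Resolver (resp. Spoiler) has a winning strategy in both games; $o=\mathcal{N}$ if the first player has a winning strategy in each game. $R_{\rm MB}$, $R'_{\rm MB}$ are the minimum numbers of moves Resolver needs to win the R-game, resp. S-game; $S_{\rm MB}$, $S'_{\rm MB}$ the minimum numbers of moves Spoiler needs to win the R-game, resp. S-game (each $\infty$ if no winning strategy). *)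

(* Defs.v *)
From mathcomp Require Import all_boot.
From mathcomp Require Import boolp.
Set Implicit Arguments.
Unset Strict Implicit.
Unset Printing Implicit Defensive.

Record sgraph := SGraph {
  vertex :> finType;
  adj : rel vertex;
  adj_sym : symmetric adj;
  adj_irr : irreflexive adj
}.
Arguments adj {s}.

Definition walk (G : sgraph) (k : nat) (x y : G) : bool :=
  [exists p : k.-tuple G, path adj x p && (last x p == y)].

(* A shortest walk has length < #|G|; the value #|G| (the size of the list)
   stands for infinity when y is not reachable from x. *)
Definition dist (G : sgraph) (x y : G) : nat :=
  find (fun k => walk k x y) (iota 0 #|G|).

Definition resolving (G : sgraph) (W : {set G}) : bool :=
  [forall x, forall y, (x != y) ==> [exists z in W, dist x z != dist y z]].

Definition metric_dim (G : sgraph) : nat :=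
  #|[arg min_(W < [set: G] | resolving W) #|W| ]|.

Section Bouquet.
Variables (m : nat) (l : 'I_m -> nat).

(* The disjoint union of the m cycles: cycle i has vertices 0, ..., l i - 1. *)
Definition cycles_vertex := {i : 'I_m & 'I_(l i)}.

Definition cycles_adj (u v : cycles_vertex) : bool :=
  (tag u == tag v) &&
  (((tagged u).+1 == tagged v %[mod l (tag u)]) ||
   ((tagged v).+1 == tagged u %[mod l (tag u)])).

(* q is the quotient map that identifies the vertices 0 of all the cycles and
   nothing else; the edges of G are the images of the edges of the cycles. *)
Definition is_bouquet (G : sgraph) : Prop :=
  (forall i, 3 <= l i) /\
  exists q : cycles_vertex -> G,
    [/\ forall x, exists u, q u = x,
        forall u v, q u = q v <->
          u = v \/ (tagged u = 0 :> nat /\ tagged v = 0 :> nat)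
      & forall x y, adj x y <->
          exists u v, [/\ cycles_adj u v, q u = x & q v = y]].

End Bouquet.

Inductive player := Resolver | Spoiler.

Section Game.
Variable G : sgraph.

(* A history is the duplicate-free list of the vertices selected so far, oldest
   first.  The player [first] makes the moves of index 0, 2, 4, ... *)
Definition history := seq G.

Definition has_turn (first P : player) (n : nat) : bool :=
  match first, P with
  | Resolver, Resolver | Spoiler, Spoiler => ~~ odd n
  | _, _ => odd n
  end.

Definition claimed (first P : player) (h : history) : {set G} :=
  [set x in h | has_turn first P (index x h)].

Definition complete_play (h : history) : Prop := uniq h /\ size h = #|G|.

Definition strategy := history -> G.

Definition legal (s : strategy) : Prop :=
  forall h, uniq h -> size h < #|G| -> s h \notin h.

Definition follows (first P : player) (s : strategy) (h : history) : Prop :=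
  forall h1 x, prefix (rcons h1 x) h -> has_turn first P (size h1) -> x = s h1.

Definition wins_play (first P : player) (h : history) : Prop :=
  let resolver_wins :=
    exists2 h1, prefix h1 h & resolving (claimed first Resolver h1) in
  match P with
  | Resolver => resolver_wins
  | Spoiler => ~ resolver_wins
  end.

Definition has_winning_strategy (first P : player) : Prop :=
  exists2 s, legal s &
    forall h, complete_play h -> follows first P s h -> wins_play first P h.

(* The win of P is already certain at h.  For Spoiler this means that even all
   the vertices not selected by Spoiler would not form a resolving set. *)
Definition has_won (first P : player) (h : history) : bool :=
  match P with
  | Resolver => resolving (claimed first Resolver h)
  | Spoiler => ~~ resolving (~: claimed first Spoiler h)
  end.

Definition wins_within (first P : player) (k : nat) : Prop :=
  exists2 s, legal s &
    forall h, complete_play h -> follows first P s h ->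
      exists h1, [/\ prefix h1 h, #|claimed first P h1| <= k
                   & has_won first P h1].

(* Only the moves of P are counted; None is infinity. *)
Definition min_moves (first P : player) : option nat :=
  match pselect (exists k, `[< wins_within first P k >]) with
  | left ex_k => Some (ex_minn ex_k)
  | right _ => None
  end.

Definition R_MB : option nat := min_moves Resolver Resolver.
Definition R'_MB : option nat := min_moves Spoiler Resolver.
Definition S_MB : option nat := min_moves Resolver Spoiler.
Definition S'_MB : option nat := min_moves Spoiler Spoiler.

End Game.

Inductive outcome := outcome_R | outcome_N | outcome_S.

Definition has_outcome (G : sgraph) (o : outcome) : Prop :=
  match o with
  | outcome_R => has_winning_strategy G Resolver Resolver /\
                 has_winning_strategy G Spoiler Resolver
  | outcome_N => has_winning_strategy G Resolver Resolver /\
                 has_winning_strategy G Spoiler Spoiler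
  | outcome_S => has_winning_strategy G Resolver Spoiler /\
                 has_winning_strategy G Spoiler Spoiler
  end.

(* Main.v *)
Require Import Defs.
From mathcomp Require Import all_boot.
From mathcomp Require Import boolp zify.
Set Implicit Arguments.
Unset Strict Implicit.
Unset Printing Implicit Defensive.

(** A set resolves a bouquet iff it contains, on every cycle, a vertex other than
the centre and its antipode, and at most one cycle is bad, i.e. has a neighbour of
the centre that is reached from all the chosen vertices of the cycle through the
centre.  An odd cycle can be served by either of the two vertices farthest from the
centre, an even cycle of length at least 6 by one vertex on each side, and one even
cycle needs a single vertex; with at most two 4-cycles this yields exactly
[metric_dim G] disjoint pairs each of which Resolver has to hit, so a pairing
strategy is optimal.  With three 4-cycles one pair degenerates to a single vertex,
which Resolver must take at once.  Conversely Spoiler, facing three untouched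
4-cycles, plays next to the centre in one of them, which forces Resolver to take the
other neighbour, then takes the antipode, and repeats this in a second 4-cycle:
two cycles are then bad. *)

(** * Plays and strategies *)

Section Games.
Variable G : sgraph.
Implicit Types (h : seq G) (x y : G) (f P : player).

Definition opponent P := if P is Resolver then Spoiler else Resolver.

Lemma has_turnS f P n : has_turn f P n.+1 = ~~ has_turn f P n.
Proof. by case: f P => -[] /=; rewrite ?negbK. Qed.

Lemma has_turn_opponent f P n : has_turn f (opponent P) n = ~~ has_turn f P n.
Proof. by case: f P => -[] /=; rewrite ?negbK. Qed.

Lemma claimed_nil f P : claimed f P [::] = set0 :> {set G}.
Proof. by apply/setP=> x; rewrite !inE. Qed.

Lemma claimed_rcons f P h x : x \notin h ->
  claimed f P (rcons h x) =
  if has_turn f P (size h) then x |: claimed f P h else claimed f P h.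
Proof.
move=> xh; apply/setP=> y; rewrite [LHS]inE mem_rcons inE -cats1 index_cat.
have [->|yx] := eqVneq y x; rewrite /= ?eqxx.
  rewrite (negbTE xh) addn0; case: ifP => _; first by rewrite !inE eqxx.
  by rewrite inE (negbTE xh).
by case yh: (y \in h); case: (has_turn f P (size h)); rewrite !inE ?(negbTE yx) yh.
Qed.

Lemma claimed_sub f P h x : x \in claimed f P h -> x \in h.
Proof. by rewrite inE => /andP[]. Qed.

Lemma claimed_prefix f P h1 h : prefix h1 h -> claimed f P h1 \subset claimed f P h.
Proof.
case/prefixP=> h2 ->; apply/subsetP=> x; rewrite !inE mem_cat index_cat.
by case/andP=> -> ->.
Qed.

Lemma claimed_disjoint f P h x :
  x \in claimed f P h -> x \notin claimed f (opponent P) h.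
Proof. by rewrite !inE has_turn_opponent => /andP[-> ->]. Qed.

Lemma unplayed_exists h : size h < #|G| -> exists x, x \notin h.
Proof.
move=> hG; case: (pickP (fun x => x \notin h)) => [x xh|nx]; first by exists x.
suff: #|G| <= size h by rewrite leqNgt hG.
apply: leq_trans (card_size h); apply/subset_leq_card/subsetP=> x _.
by have := nx x; case: (x \in h).
Qed.

Lemma unplayed_size h x : uniq h -> x \notin h -> size h < #|G|.
Proof.
move=> uh xh; have : uniq (x :: h) by rewrite /= xh.
by move/card_uniqP => /= <-; apply: max_card.
Qed.

Lemma follows_prefix f P s h1 h :
  prefix h1 h -> follows f P s h -> follows f P s h1.
Proof. by move=> p1 F h2 x p2; apply: F; apply: prefix_trans p1. Qed.

Lemma follows_rcons f P s h x : follows f P s h ->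
  (has_turn f P (size h) -> x = s h) -> follows f P s (rcons h x).
Proof.
move=> F X h1 y /prefixP[h2]; elim/last_ind: h2 => [|h2 z _].
  by rewrite cats0 => /rcons_inj[<- <-].
by rewrite -rcons_cat => /rcons_inj[e _]; apply: F; rewrite e prefix_prefix.
Qed.

(** Letting each strategy move in its turn builds a full play. Such a confrontation gives all lower
    bounds on numbers of moves and shows that the players cannot both win. *)
Lemma play_exists f (s1 s2 : strategy G) : legal s1 -> legal s2 ->
  exists h, [/\ complete_play h, follows f Resolver s1 h & follows f Spoiler s2 h].
Proof.
move=> l1 l2.
have H n : n <= #|G| ->
    exists h, [/\ uniq h, size h = n, follows f Resolver s1 h & follows f Spoiler s2 h].
  elim: n => [|n IH] nG; first by exists [::]; split=> // h1 x; rewrite prefixs0 -size_eq0 size_rcons.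
  have [h [uh sh F1 F2]] := IH (ltnW nG).
  exists (rcons h (if has_turn f Resolver (size h) then s1 h else s2 h)).
  split; rewrite ?size_rcons ?sh //; last first.
  - apply: follows_rcons => //; rewrite sh.
    by rewrite (has_turn_opponent f Resolver) => /negbTE->.
  - by apply: follows_rcons => //; rewrite sh => ->.
  by rewrite rcons_uniq uh andbT; case: ifP => _; [apply: l1|apply: l2]; rewrite ?sh.
by have [h [uh sh F1 F2]] := H _ (leqnn _); exists h.
Qed.

(** The strategy chooses a move that restores [Inv] when there is one, and otherwise any unplayed
    vertex, which keeps it legal off the histories of interest. Induction along a history then
    carries [Inv]. *)
Lemma invariant_strategy f P (x0 : G) (Inv : seq G -> Prop) :
  Inv [::] ->
  (forall h, uniq h -> size h < #|G| -> Inv h -> has_turn f P (size h) ->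
     exists2 x, x \notin h & Inv (rcons h x)) ->
  (forall h x, uniq h -> x \notin h -> Inv h -> ~~ has_turn f P (size h) ->
     Inv (rcons h x)) ->
  exists2 s : strategy G, legal s & forall h, uniq h -> follows f P s h -> Inv h.
Proof.
move=> I0 IP IO.
pose Q h := exists x, x \notin h /\ Inv (rcons h x).
pose s h := match pselect (Q h) with
            | left q => sval (cid q)
            | right _ => odflt x0 [pick x | x \notin h] end.
exists s => [h uh sh|h]; rewrite ?/s.
  case: pselect => [q|_]; first by case: (svalP (cid q)).
  case: pickP => [x //|nx]; have [x xh] := unplayed_exists sh.
  by rewrite nx in xh.
elim/last_ind: h => [//|h x IH]; rewrite rcons_uniq => /andP[xh uh] F.
have Ih := IH uh (follows_prefix (prefix_rcons _ _) F).
have sh := unplayed_size uh xh.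
case T: (has_turn f P (size h)); last by apply: IO => //; rewrite T.
rewrite (F h x (prefix_refl _) T) /s; case: pselect => [q|nq].
  by case: (svalP (cid q)).
by case: nq; have [y yh Iy] := IP h uh sh Ih T; exists y.
Qed.

Lemma resolving_mono (W W' : {set G}) : W \subset W' -> resolving W -> resolving W'.
Proof.
move=> sW /forallP rW; apply/forallP=> x; apply/forallP=> y; apply/implyP=> xy.
have /forallP/(_ y)/implyP/(_ xy)/exists_inP[z zW d] := rW x.
by apply/exists_inP; exists z => //; apply: (subsetP sW).
Qed.

Lemma wins_within_leq f P j k : j <= k -> wins_within G f P j -> wins_within G f P k.
Proof.
move=> jk [s ls H]; exists s => // h ch F; have [h1 [p1 c1 w1]] := H h ch F.
by exists h1; split=> //; apply: leq_trans c1 jk.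
Qed.

(** For Spoiler: all vertices that Resolver ever claims avoid those held by Spoiler at [h1], so they
    lie in a set that is not resolving. *)
Lemma wins_within_winning f P k : wins_within G f P k -> has_winning_strategy G f P.
Proof.
case=> s ls H; exists s => // h ch F; have [h1 [p1 _ w1]] := H h ch F.
case: P w1 {H F} => /= w1; first by exists h1.
case=> h2 p2 r2; case/negP: w1; apply: resolving_mono r2.
apply/subsetP=> x x2; rewrite inE; apply/negP=> x1.
have := claimed_disjoint (subsetP (claimed_prefix f Resolver p2) x x2).
by rewrite (subsetP (claimed_prefix f Spoiler p1) x x1).
Qed.

Lemma winning_exclusive f :
  has_winning_strategy G f Resolver -> has_winning_strategy G f Spoiler -> False.
Proof.
move=> [s1 l1 H1] [s2 l2 H2]; have [h [ch F1 F2]] := play_exists f l1 l2.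
exact: H2 F2 (H1 _ ch F1).
Qed.

Lemma min_moves_eq f P k : wins_within G f P k ->
  (forall j, wins_within G f P j -> k <= j) -> min_moves G f P = Some k.
Proof.
move=> wk minik; rewrite /min_moves; case: pselect => [ex|[]]; last first.
  by exists k; apply/asboolP.
congr Some; case: ex_minnP => n /asboolP wn mn; apply/eqP.
by rewrite eqn_leq minik // mn //; apply/asboolP.
Qed.

(** The minimum ranges over a nonempty family once the whole vertex set resolves; by monotonicity
    any resolving [W] guarantees this. *)
Lemma metric_dimP (W : {set G}) : resolving W ->
  exists2 W : {set G}, resolving W & metric_dim G = #|W|.
Proof.
move=> rW; rewrite /metric_dim; case: arg_minnP; last by move=> W' rW' _; exists W'.
by apply: resolving_mono rW; apply: subsetT.
Qed.

Lemma metric_dim_leq (W : {set G}) : resolving W -> metric_dim G <= #|W|.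
Proof.
move=> rW; rewrite /metric_dim; case: arg_minnP; last by move=> W' _; apply.
by apply: resolving_mono rW; apply: subsetT.
Qed.

Lemma resolver_lower_bound f k : wins_within G f Resolver k -> metric_dim G <= k.
Proof.
(* Spoiler's moves are irrelevant here, so [s] is also used for him. *)
case=> s ls H; have [h [ch F _]] := play_exists f ls ls.
have [h1 [_ c1 w1]] := H h ch F.
exact: leq_trans (metric_dim_leq w1) c1.
Qed.

(** * Pairing strategies for Resolver *)

Section Pairing.
Variables (T : finType) (D : {set T}) (B : T -> {set G}).
Hypothesis B_disjoint : forall t u x,
  t \in D -> u \in D -> x \in B t -> x \in B u -> t = u.
Hypothesis B_nonempty : forall t, t \in D -> B t != set0.

Let hit (W : {set G}) := [set t in D | B t :&: W != set0].
Let available h t := exists2 x, x \in B t & x \notin h.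
Let safe h t := 2 <= #|B t| /\ forall x, x \in B t -> x \notin h.

(* While it is Resolver's turn at most one block missed by him is unsafe; he plays
   there if it exists, so that each of his moves hits a new block until all are hit. *)
Let pairing_inv f h :=
  (exists h1, [/\ prefix h1 h, #|claimed f Resolver h1| <= #|D|
                & D \subset hit (claimed f Resolver h1)]) \/
  (#|claimed f Resolver h| <= #|hit (claimed f Resolver h)| /\
   if has_turn f Resolver (size h) then
     (forall t, t \in D -> t \notin hit (claimed f Resolver h) -> available h t) /\
     (forall t u, t \in D -> u \in D -> t \notin hit (claimed f Resolver h) ->
        u \notin hit (claimed f Resolver h) -> t != u -> safe h t \/ safe h u)
   else forall t, t \in D -> t \notin hit (claimed f Resolver h) -> safe h t).

Lemma safe_available h t : safe h t -> available h t.
Proof.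
case=> c s; have /card_gt0P[x xB] : 0 < #|B t| by apply: leq_trans c.
by exists x => //; apply: s.
Qed.

(** The first conclusion, valid at every moment of play, bounds Spoiler's speed from below; the
    second gives Resolver's win. A single block of size 1 is tolerable only if Resolver moves first
    and can take it at once. *)
Lemma pairing_strategy f (x0 : G) :
  (forall t u, t \in D -> u \in D -> t != u -> 2 <= #|B t| \/ 2 <= #|B u|) ->
  (f = Spoiler -> forall t, t \in D -> 2 <= #|B t|) ->
  exists2 s : strategy G, legal s & forall h, uniq h -> follows f Resolver s h ->
    (forall t, t \in D -> ~~ (B t \subset claimed f Spoiler h)) /\
    (size h = #|G| -> exists h1, [/\ prefix h1 h, #|claimed f Resolver h1| <= #|D|
        & forall t, t \in D -> B t :&: claimed f Resolver h1 != set0]).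
Proof.
move=> B2 BS.
have [|||s ls H] := @invariant_strategy f Resolver x0 (pairing_inv f).
- right; rewrite claimed_nil cards0; split=> //=.
  case: f BS => /= [_|/(_ erefl) BS]; last by move=> t tD _; split=> //; apply: BS.
  split=> [t tD _|t u tD uD _ _ /(B2 t u tD uD)].
    by have /set0Pn[x xB] := B_nonempty tD; exists x.
  by case=> c; [left|right]; split.
- move=> h uh sh [[h1 [p1 c1 r1]] _|].
    have [x xh] := unplayed_exists sh; exists x => //; left; exists h1; split=> //.
    exact: prefix_trans p1 (prefix_rcons _ _).
  set W := claimed _ _ h => -[cW] /[swap] Tr; rewrite Tr => -[av sf].
  have [allhit|] := boolP (D \subset hit W).
    have [x xh] := unplayed_exists sh; exists x => //; left; exists h.
    split; rewrite ?prefix_rcons //; apply: leq_trans cW _.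
    by apply/subset_leq_card/subsetP=> t; rewrite inE => /andP[].
  case/subsetPn=> t0 t0D t0h.
  (* The block to play in: the unsafe one if it exists, otherwise any block not yet hit. All other
     missed blocks are then safe. *)
  have [t [tD th tu]] : exists t, [/\ t \in D, t \notin hit W &
      forall u, u \in D -> u \notin hit W -> u != t -> safe h u].
    have [[t [tD th ns]]|nt] := pselect (exists t, [/\ t \in D, t \notin hit W & ~ safe h t]).
      by exists t; split=> // u uD uh' ut; case: (sf u t uD tD uh' th ut).
    exists t0; split=> // u uD uh' _.
    by case: (pselect (safe h u)) => // ns; case: nt; exists u.
  have [x xB xh] := av t tD th; exists x => //.
  right; rewrite size_rcons has_turnS Tr /= claimed_rcons // Tr.
  have sub : t |: hit W \subset hit (x |: W).
    apply/subsetP=> u; rewrite !inE => /orP[/eqP->|/andP[-> /set0Pn[y]]] /=.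
      by rewrite tD; apply/set0Pn; exists x; rewrite !inE xB eqxx.
    by rewrite in_setI => /andP[yB yW]; apply/set0Pn; exists y; rewrite in_setI in_setU yB yW orbT.
  split=> [|u uD uh'].
    apply: leq_trans (subset_leq_card sub).
    by rewrite !cardsU1 th leq_add // leq_b1.
  have un : u \notin t |: hit W by apply: contra uh'; apply: (subsetP sub).
  move: un; rewrite in_setU1 negb_or => /andP[ut uhW].
  have [c s] := tu u uD uhW ut; split=> // y yB; rewrite mem_rcons inE negb_or s // andbT.
  by apply: contraNneq ut => yx; apply/eqP/(B_disjoint uD tD yB); rewrite yx.
- move=> h x uh xh [[h1 [p1 c1 r1]] _|].
    left; exists h1; split=> //; exact: prefix_trans p1 (prefix_rcons _ _).
  move=> [cW] /[swap] Tr; rewrite (negbTE Tr) => sf.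
  right; rewrite size_rcons has_turnS Tr claimed_rcons // (negbTE Tr); split=> //.
  (* Spoiler's move removes at most one vertex from a safe block and, by disjointness, touches at
     most one block. *)
  split=> [t tD th|t u tD uD th uh' tu].
    have [c s] := sf t tD th.
    have /set0Pn[y] : B t :\ x != set0.
      by rewrite -card_gt0; move: c; rewrite (cardsD1 x); case: (x \in _); lia.
    rewrite !inE => /andP[yx yB]; exists y => //.
    by rewrite mem_rcons inE negb_or yx s.
  have [ct st] := sf t tD th; have [cu su] := sf u uD uh'.
  have [xt|xt] := boolP (x \in B t).
    right; split=> // y yB; rewrite mem_rcons inE negb_or su // andbT.
    by apply: contraNneq tu => yx; apply/eqP/(B_disjoint tD uD xt); rewrite -yx.
  left; split=> // y yB; rewrite mem_rcons inE negb_or st // andbT.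
  by apply: contraNneq xt => <-.
exists s => // h uh F.
have hitN (W : {set G}) t : t \in hit W -> B t :&: W != set0 by rewrite inE => /andP[].
have hitS t : t \in hit (claimed f Resolver h) -> ~~ (B t \subset claimed f Spoiler h).
  move/hitN/set0Pn=> [x]; rewrite inE => /andP[xB xW]; apply/subsetPn; exists x => //.
  exact: claimed_disjoint xW.
case: (H h uh F) => [[h1 [p1 c1 r1]]|[cW av]].
  split=> [t tD|_]; last by exists h1; split=> // t /(subsetP r1)/hitN.
  apply: hitS; have := subsetP r1 t tD; rewrite !inE tD /=.
  by apply: contraNneq => e; rewrite -subset0 -e setIS // claimed_prefix.
have {}av t : t \in D -> t \notin hit (claimed f Resolver h) -> available h t.
  case: ifP av => [_ [av _]|_ sf tD th]; first exact: av.
  by apply: safe_available; apply: sf.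
split=> [t tD|sh].
  have [/hitS //|th] := boolP (t \in hit (claimed f Resolver h)).
  have [x xB xh] := av t tD th; apply/subsetPn; exists x => //.
  by apply: contra xh; apply: claimed_sub.
exists h; split; rewrite ?prefix_refl //.
  apply: leq_trans cW _.
  by apply/subset_leq_card/subsetP=> t; rewrite inE => /andP[].
move=> t tD; apply: hitN; apply: contraT => th.
(* A missed block would still hold an unplayed vertex, which a full board excludes. *)
have [x xB xh] := av t tD th.
by have := unplayed_size uh xh; rewrite sh ltnn.
Qed.

End Pairing.

Lemma pairing_wins (T : finType) (D : {set T}) (B : T -> {set G}) f (x0 : G) :
  (forall t u x, t \in D -> u \in D -> x \in B t -> x \in B u -> t = u) ->
  (forall t, t \in D -> B t != set0) ->
  (forall t u, t \in D -> u \in D -> t != u -> 2 <= #|B t| \/ 2 <= #|B u|) ->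
  (f = Spoiler -> forall t, t \in D -> 2 <= #|B t|) ->
  (forall W : {set G}, (forall t, t \in D -> B t :&: W != set0) -> resolving W) ->
  wins_within G f Resolver #|D|.
Proof.
move=> Bd B0 B2 BS BW; have [s ls H] := pairing_strategy Bd B0 x0 B2 BS.
exists s => // h [uh sh] F; have [_ /(_ sh) [h1 [p1 c1 r1]]] := H h uh F.
by exists h1; split=> //; apply: BW.
Qed.

(** The index bounds only the remaining moves of [P]. The vertex [y] in [wins_reply] certifies that
    play is not over; without it the quantification over replies could be vacuous. *)
Inductive wins_from f P : nat -> seq G -> Prop :=
| wins_now k h : has_won f P h -> wins_from f P k h
| wins_move k h x : has_turn f P (size h) -> x \notin h ->
    wins_from f P k (rcons h x) -> wins_from f P k.+1 h
| wins_reply k h y : ~~ has_turn f P (size h) -> y \notin h ->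
    (forall x, x \notin h -> wins_from f P k (rcons h x)) -> wins_from f P k h.

Lemma wins_from_within f P (x0 : G) k : wins_from f P k [::] -> wins_within G f P k.
Proof.
move=> w0.
pose won h := exists h1, [/\ prefix h1 h, #|claimed f P h1| <= k & has_won f P h1].
(* Either the win has occurred within budget, or the moves spent plus the moves still allowed stay
   at most [k]. *)
pose Inv h := won h \/ exists2 j, #|claimed f P h| + j <= k & wins_from f P j h.
have won_rcons h x : won h -> won (rcons h x).
  case=> h1 [p1 c1 r1]; exists h1; split=> //; exact: prefix_trans p1 (prefix_rcons _ _).
have won_now h j : #|claimed f P h| + j <= k -> has_won f P h -> won h.
  by move=> c w; exists h; split; rewrite ?prefix_refl //; apply: leq_trans c; apply: leq_addr.
have [|||s ls H] := @invariant_strategy f P x0 Inv.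
- by right; exists k => //; rewrite claimed_nil cards0.
- move=> h uh sh + Tr; have [y yh] := unplayed_exists sh.
  case=> [w|[j c w]]; first by exists y => //; left; apply: won_rcons.
  case: w c Tr yh => {sh}[i h' w c Tr yh|i h' x _ xh w c Tr yh|i h' z /negbTE-> //].
    by exists y => //; left; apply: won_rcons; exact: won_now c w.
  exists x => //; right; exists i => //; rewrite claimed_rcons // Tr cardsU1.
  by move: c; case: (_ \in _) => /=; lia.
- move=> h x uh xh + Tr.
  case=> [w|[j c w]]; first by left; apply: won_rcons.
  case: w c Tr xh => [i h' w c Tr xh|i h' z -> //|i h' z _ _ w c Tr xh].
    by left; apply: won_rcons; exact: won_now c w.
  by right; exists i; [rewrite claimed_rcons // (negbTE Tr)|apply: w].
exists s => // h [uh sh] F; have [//|[j c w]] := H h uh F.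
have full x : x \in h by apply: contraT => /(unplayed_size uh); rewrite sh ltnn.
case: w c full {uh sh F} => [i h' w c _|i h' x _ + _ _ full|i h' x _ + _ _ full].
- exact: won_now c w.
- by rewrite full.
- by rewrite full.
Qed.

End Games.

(** * Distances in a bouquet *)

Lemma walkP (G : sgraph) k (x y : G) :
  reflect (exists s, [/\ size s = k, path adj x s & last x s = y]) (walk k x y).
Proof.
apply: (iffP existsP) => [[p /andP[pp /eqP lp]]|[s [sk ps ls]]].
  by exists p; rewrite size_tuple.
by exists (Tuple (introT eqP sk)); rewrite /= ps ls eqxx.
Qed.

(** The Lipschitz condition bounds every walk to [y] below by [f], and descending along [f] produces
    a walk of exactly that length. *)
Lemma dist_potential (G : sgraph) (y : G) (f : G -> nat) :
  (forall x, f x = 0 <-> x = y) ->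
  (forall u v, adj u v -> f u <= (f v).+1) ->
  (forall u, 0 < f u -> exists2 v, adj u v & f u = (f v).+1) ->
  forall x, dist x y = f x.
Proof.
move=> f0 fL fD x.
have low k z : walk k z y -> f z <= k.
  case/walkP=> s [<- + ls]; elim: s z ls => [|w s IH] z /= ls.
    by rewrite (proj2 (f0 z) ls).
  by case/andP=> zw /(IH _ ls) h; apply: leq_trans (fL _ _ zw) _.
have ex n z : f z = n -> exists s, [/\ size s = n, path adj z s & last z s = y].
  elim: n z => [|n IH] z fz; first by exists [::]; split=> //=; apply/f0.
  have [w zw] : exists2 v, adj z v & f z = (f v).+1 by apply: fD; rewrite fz.
  rewrite fz => -[/esym/IH[s [ss ps ls]]].
  by exists (w :: s); split=> //=; rewrite ?ss ?zw.
have lev n k z : f z = k -> n <= k -> exists w, f w == n.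
  elim: k z => [|k IH] z fz.
    by rewrite leqn0 => /eqP->; exists z; rewrite fz.
  rewrite leq_eqVlt => /predU1P[->|nk]; first by exists z; rewrite fz.
  have [w _] : exists2 v, adj z v & f z = (f v).+1 by apply: fD; rewrite fz.
  by rewrite fz => -[/esym/IH]; apply.
(* The values 0 to [f x] are all attained, at distinct vertices. Hence the search in [dist] reaches
   [f x] before its default value. *)
have fG : f x < #|G|.
  pose g (i : 'I_(f x).+1) := xchoose (lev i _ x erefl (ltnSE (ltn_ord i))).
  have gi : injective g.
    move=> i j e; apply: val_inj => /=.
    have gE k : f (g k) = k by apply/eqP/(xchooseP (lev k _ x erefl _)).
    by rewrite -[LHS]gE e gE.
  by have := leq_card g gi; rewrite card_ord.
have wx : walk (f x) x y by apply/walkP/ex.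
have hs : has (fun k => walk k x y) (iota 0 #|G|).
  by apply/hasP; exists (f x) => //; rewrite mem_iota.
apply/eqP; rewrite /dist eqn_leq; apply/andP; split.
  rewrite leqNgt; apply/negP=> /(before_find 0).
  by rewrite nth_iota // add0n wx.
apply: low; have := nth_find 0 hs; rewrite nth_iota ?add0n //.
by rewrite has_find size_iota in hs.
Qed.

(** The shorter arc between two positions; the truncated differences add up to their absolute
    difference. With [dep], the distance to position 0, and the mod-free [next], this stays within
    linear arithmetic. *)
Definition cyc (L p r : nat) := minn ((p - r) + (r - p)) (L - ((p - r) + (r - p))).
Definition dep (L p : nat) := minn p (L - p).
Definition next (L p r : nat) := (r == p.+1) || (p.+1 == L) && (r == 0).

Lemma modS_next L p r : p < L -> r < L -> (p.+1 == r %[mod L]) = next L p r.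
Proof.
move=> pL rL; rewrite /next (modn_small rL).
have [->|pn] := eqVneq p.+1 L; first by rewrite modnn; lia.
by rewrite modn_small; lia.
Qed.

Lemma cyc0 L p : p < L -> cyc L p 0 = dep L p.
Proof. by rewrite /cyc /dep subn0 sub0n addn0. Qed.

Lemma cyc0r L p : p < L -> cyc L 0 p = dep L p.
Proof. by rewrite /cyc /dep subn0 sub0n. Qed.

Lemma cyc_Lipschitz L p p' r : p < L -> p' < L -> r < L ->
  next L p p' || next L p' p -> cyc L p r <= (cyc L p' r).+1.
Proof. by rewrite /cyc /next; lia. Qed.

Lemma cyc_descent L p r : p < L -> r < L -> 0 < cyc L p r ->
  exists p', [/\ p' < L, next L p p' || next L p' p & cyc L p r = (cyc L p' r).+1].
Proof.
rewrite /cyc /next => pL rL h.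
(* The test compares the order of the positions with whether the direct arc is the shorter one;
   agreement means that the shorter arc leaves [p] upwards. *)
have [up|down] := boolP ((p < r) == (2 * ((p - r) + (r - p)) <= L)).
  by have [e|e] := eqVneq p.+1 L; [exists 0|exists p.+1]; split; lia.
by have [e|e] := eqVneq p 0; [exists L.-1|exists p.-1]; split; lia.
Qed.

(** Plain natural numbers as positions avoid transport between the types of positions on different
    cycles. The centre is position 0 of every cycle. *)
Record bouquet_coordinates (G : sgraph) m (l : 'I_m -> nat) (pt : 'I_m -> nat -> G) := {
  len_ge3 : forall i, 3 <= l i;
  pt_surj : forall x, exists i p, p < l i /\ x = pt i p;
  pt_eq : forall i j p r, p < l i -> r < l j ->
    pt i p = pt j r <-> (i = j /\ p = r) \/ (p = 0 /\ r = 0);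
  pt_adj : forall x y, adj x y <-> exists i p r,
    [/\ p < l i, r < l i, x = pt i p, y = pt i r & next (l i) p r || next (l i) r p]
}.

Lemma bouquet_has_coordinates (G : sgraph) m (l : 'I_m -> nat) :
  is_bouquet l G -> exists pt, @bouquet_coordinates G m l pt.
Proof.
case=> l3 [q [qs qe qa]].
have l0 i : 0 < l i by apply: leq_trans (l3 i).
(* Reduction modulo the length makes [pt] total; only positions below the length matter. *)
pose V i p : cycles_vertex l := Tagged (fun i => 'I_(l i)) (Ordinal (ltn_pmod p (l0 i))).
have VE (u : cycles_vertex l) : u = V (tag u) (tagged u).
  by case: u => i p; congr Tagged; apply: val_inj; rewrite /= modn_small.
exists (fun i p => q (V i p)); split=> //.
- by move=> x; have [u <-] := qs x; exists (tag u), (tagged u); rewrite -VE.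
- move=> i j p r pi rj; rewrite qe /= !modn_small //; split=> -[]; try by right.
    move=> e; left; have ij : i = j := congr1 tag e.
    split=> //; case: _ / ij rj e => ri e.
    by have := congr1 (fun u : cycles_vertex l => tagged u : nat) e; rewrite /= !modn_small.
  by case=> -> ->; left.
- move=> x y; rewrite qa; split.
    case=> -[i p] [[j r] [/andP[/= /eqP ij h] <- <-]]; subst j.
    exists i, p, r; rewrite -!modS_next //.
    by split=> //; congr q; apply: (VE (Tagged _ _)).
  case=> i [p [r [pi ri -> -> h]]]; exists (V i p), (V i r).
  by split=> //; rewrite /cycles_adj eqxx /= !modn_mod !modS_next // !modn_small.
Qed.

Section Bouquet.
Variables (G : sgraph) (m : nat) (l : 'I_m -> nat) (pt : 'I_m -> nat -> G).
Hypothesis Gl : bouquet_coordinates l pt.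

Let l3 := len_ge3 Gl.
Let l0 i : 0 < l i. Proof. exact: leq_trans (l3 i). Qed.

Lemma pt_inj i j p r : 0 < p < l i -> 0 < r < l j -> pt i p = pt j r ->
  i = j /\ p = r.
Proof.
by case/andP=> p0 pl /andP[r0 rl] /(pt_eq Gl pl rl)[//|[e]]; rewrite e in p0.
Qed.

Lemma pt0 i j : pt i 0 = pt j 0.
Proof. by apply/(pt_eq Gl) => //; right. Qed.

Definition bdist i p j r :=
  if i == j then cyc (l i) p r else dep (l i) p + dep (l j) r.

Lemma dist_pt i j p r : p < l i -> r < l j -> dist (pt i p) (pt j r) = bdist i p j r.
Proof.
move=> pi rj.
have coP x : exists c : 'I_m * nat, c.2 < l c.1 /\ x = pt c.1 c.2.
  by have [k [s [sk ->]]] := pt_surj Gl x; exists (k, s).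
pose co x := sval (cid (coP x)).
have coE x : (co x).2 < l (co x).1 /\ x = pt (co x).1 (co x).2 by apply: (svalP (cid (coP x))).
pose f x := bdist (co x).1 (co x).2 j r.
(* The centre has several coordinates; the potential does not depend on the one chosen, because the
   depth of position 0 is 0. *)
have fE k s : s < l k -> f (pt k s) = bdist k s j r.
  move=> sk; have [cl /(pt_eq Gl sk cl)] := coE (pt k s); rewrite /f.
  case=> [[<- <-] //|[-> ->]]; rewrite /bdist.
  have d0 i' : dep (l i') 0 = 0 by rewrite /dep min0n.
  by case: eqP => [->|_]; case: eqP => [->|_]; rewrite ?cyc0r ?d0.
rewrite -fE //; apply: dist_potential => [x|u v|u].
- have [k [s [sk ->]]] := pt_surj Gl x; rewrite fE // (pt_eq Gl sk rj) /bdist.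
  case: eqP => [kj|nkj].
    subst k; rewrite /cyc; split=> [h|[[_ ->]|[-> ->]]]; try lia.
    by left; split=> //; lia.
  rewrite /dep; split=> [|[[/nkj]//|]]; lia.
- case/(pt_adj Gl)=> k [s [s' [sk sk' -> -> h]]]; rewrite !fE // /bdist.
  case: eqP => [kj|_]; first by subst k; apply: cyc_Lipschitz.
  have := cyc_Lipschitz sk sk' (l0 k) h; rewrite !cyc0 //; lia.
- have [k [s [sk ->]]] := pt_surj Gl u.
  have move_in k' s' t : s' < l k' -> t < l k' -> 0 < cyc (l k') s' t ->
      exists p', [/\ p' < l k', adj (pt k' s') (pt k' p')
                   & cyc (l k') s' t = (cyc (l k') p' t).+1].
    move=> sk' tk /(cyc_descent sk' tk)[p' [pk' nx e]]; exists p'; split=> //.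
    by apply/(pt_adj Gl); exists k', s', p'.
  case: (posnP s) => [s0|sp].
    (* From the centre the descent enters the target's cycle [j], so the centre is first renamed as
       a point of [j]. *)
    rewrite s0 (pt0 k j) fE // /bdist eqxx => /(move_in j 0 r (l0 j) rj)[p' [pj' a e]].
    by exists (pt j p') => //; rewrite fE // /bdist eqxx.
  rewrite fE // /bdist; case: eqP => [kj|nkj].
    rewrite kj in sk *; move/(move_in j s r sk rj)=> [p' [pj' a e]].
    by exists (pt j p') => //; rewrite fE // /bdist eqxx.
  (* On a cycle other than [j] the descent goes towards the centre. *)
  have [|p' [pk' a e]] := move_in k s 0 sk (l0 k).
    by rewrite cyc0 // /dep; lia.
  rewrite !cyc0 // in e => _; exists (pt k p') => //.
  by rewrite fE // /bdist; case: eqP nkj => // _ _; rewrite e.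
Qed.

(* The neighbours of the centre on cycle [i] have positions [1] and [l i - 1];
   the cycle is bad when one of them is reached from all of [W] through the centre. *)
Definition bad_side (W : {set G}) i s :=
  forall p, p < l i -> pt i p \in W -> cyc (l i) s p = (dep (l i) p).+1.
Definition bad (W : {set G}) i := bad_side W i 1 \/ bad_side W i (l i).-1.

Definition oriented (W : {set G}) i :=
  exists2 p, 0 < p < l i /\ p.*2 != l i & pt i p \in W.

Lemma resolvingP (W : {set G}) : resolving W ->
  forall x y, x <> y -> exists2 z, z \in W & dist x z <> dist y z.
Proof.
move/forallP=> rW x y /eqP xy.
have /forallP/(_ y)/implyP/(_ xy)/exists_inP[z zW /eqP d] := rW x; by exists z.
Qed.

(** The two neighbours of the centre on cycle [i] are mirror images, so only vertices of that cycle
    off the axis through the centre separate them. *)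
Lemma resolving_oriented (W : {set G}) i : resolving W -> oriented W i.
Proof.
move/resolvingP => rW; have l3i := l3 i.
have [|z zW] := rW (pt i 1) (pt i (l i).-1).
  by move=> /pt_inj[]; lia.
have [j [p [pj e]]] := pt_surj Gl z; rewrite e in zW *.
rewrite !dist_pt //; try lia; rewrite /bdist; case: eqP => [ij|_]; last by rewrite /dep; lia.
rewrite -ij in pj zW * => d; exists p => //; move: d; rewrite /cyc; lia.
Qed.

(** On two different bad cycles, the neighbours of the centre that witness badness both have
    distance one plus its depth to every chosen vertex, so nothing separates them. *)
Lemma resolving_bad (W : {set G}) i j : resolving W -> bad W i -> bad W j -> i = j.
Proof.
move/resolvingP => rW bi bj; apply: contrapT => ij.
have side k : bad W k -> exists s, [/\ 0 < s < l k, dep (l k) s = 1 & bad_side W k s].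
  have := l3 k => lk [b|b]; [exists 1|exists (l k).-1]; split=> //; rewrite /dep; lia.
have [s [sl ds bs]] := side i bi; have [t [tl dt bt]] := side j bj.
have [/pt_inj[]//|z zW] := rW (pt i s) (pt j t).
have [k [p [pk e]]] := pt_surj Gl z; rewrite e in zW *.
rewrite !dist_pt //; try lia; rewrite /bdist ds dt.
case: (eqVneq i k) => [ik|_]; case: (eqVneq j k) => [jk|_] //.
- by case: ij; rewrite ik jk.
- by rewrite -ik in pk zW *; rewrite bs // add1n.
- by rewrite -jk in pk zW *; rewrite bt // add1n.
Qed.

(** On one cycle, a chosen vertex of another cycle fixes the depth and an oriented one excludes the
    mirror image. Unseparated vertices on different cycles have equal depth, and their chosen
    vertices are reached through the centre, which makes both cycles bad. *)
Lemma oriented_resolving (W : {set G}) : 2 <= m ->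
  (forall i, oriented W i) -> (forall i j, bad W i -> bad W j -> i = j) -> resolving W.
Proof.
move=> m2 oW bW; apply/forallP=> x; apply/forallP=> y; apply/implyP=> xy.
apply: contraT; rewrite negb_exists_in => /forall_inP nr; case/eqP: xy.
have {}nr z : z \in W -> dist x z = dist y z by move/nr/negPn/eqP.
have [i [p [pi e]]] := pt_surj Gl x; have [j [r [rj e']]] := pt_surj Gl y.
have other k : exists k' : 'I_m, k' <> k.
  have [k0|k0] := posnP k.
    by exists (Ordinal m2) => /(congr1 val) /=; rewrite k0.
  by exists (Ordinal (ltnW m2)) => /(congr1 val) /= e0; rewrite -e0 in k0.
rewrite e e' in nr *.
have same k s t : s < l k -> t < l k ->
    (forall z, z \in W -> dist (pt k s) z = dist (pt k t) z) -> pt k s = pt k t.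
  move=> sk tk {}nr; have [k' nk] := other k.
  have [w [wk _] wW] := oW k'; have [v [vk vn] vW] := oW k.
  have := nr _ wW; rewrite !dist_pt //; try lia; rewrite /bdist.
  case: eqP => [kk|_]; first by case: nk.
  have := nr _ vW; rewrite !dist_pt //; try lia; rewrite /bdist eqxx.
  move=> h1 h2; congr pt; move: vk vn h1 h2; rewrite /cyc /dep; lia.
case: (eqVneq i j) => [ij|/eqP ij]; first by subst j; apply: same.
have side k k' s t : k <> k' -> s < l k -> t < l k' -> s <> 0 ->
    (forall z, z \in W -> dist (pt k s) z = dist (pt k' t) z) ->
    dep (l k) s <= dep (l k') t -> bad W k.
  move=> kk sk tk s0 {}nr dle.
  have h v : v < l k -> pt k v \in W -> cyc (l k) s v = dep (l k') t + dep (l k) v.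
    move=> vk /nr; rewrite !dist_pt // /bdist eqxx; case: eqP => // ek; by case: kk.
  (* The neighbour of the centre on the same half as [s] lies on the geodesic from [s] through the
     centre, so it too reaches the chosen vertices that way. *)
  case: (leqP s.*2 (l k)) => sd; [left|right] => v vk /(h v vk);
    move: s0 dle; have := l3 k; rewrite /cyc /dep; lia.
case: (posnP p) => [p0|p0].
  by rewrite p0 (pt0 i j); apply: same => // z /nr; rewrite p0 (pt0 i j).
case: (posnP r) => [r0|r0].
  by rewrite r0 -(pt0 i j); apply: same => // z /nr; rewrite r0 -(pt0 i j).
(* The triangle inequality through the centre, applied to a chosen vertex of cycle [i]. *)
have dle : dep (l j) r <= dep (l i) p.
  have [v [vk vn] vW] := oW i; move: (nr _ vW); rewrite !dist_pt //; try lia.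
  rewrite /bdist eqxx; case: eqP => [ji|_]; first by case: ij.
  rewrite /cyc /dep; lia.
have dge : dep (l i) p <= dep (l j) r.
  have [v [vk vn] vW] := oW j; move: (nr _ vW); rewrite !dist_pt //; try lia.
  rewrite /bdist eqxx; case: eqP => [ji|_]; first by case: ij.
  rewrite /cyc /dep; lia.
case: (ij); apply: bW; first by apply: (side i j p r) => //; lia.
by apply: (side j i r p) => //; [exact: nesym|lia|move=> z /nr].
Qed.

(** Position [r] is reached from 1, and [p] from [(l i).-1], by an arc shorter than the way through
    the centre. One vertex can do both if it is an antipode or one of the two farthest vertices of
    an odd cycle. *)
Lemma not_bad (W : {set G}) i p r : pt i p \in W -> pt i r \in W ->
  p < l i -> l i < p.*2.+2 -> 0 < r < l i -> r.*2 < (l i).+2 -> ~ bad W i.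
Proof.
move=> pW rW pl pL r0 rL; have := l3 i => l3i.
case=> b; [have := b r _ rW|have := b p _ pW]; rewrite /cyc /dep; lia.
Qed.

Lemma not_bad_side (W : {set G}) i s : 0 < s < l i -> ~ bad_side W i s ->
  exists p, [/\ p < l i, pt i p \in W & cyc (l i) s p <> (dep (l i) p).+1].
Proof.
move=> si nb; apply: contrapT => ne; apply: nb => p pi pW.
by apply: contrapT => n; apply: ne; exists p.
Qed.

End Bouquet.

(** * Metric dimension and the games *)

Section BouquetGames.
Variables (G : sgraph) (m : nat) (l : 'I_m -> nat) (pt : 'I_m -> nat -> G).
Hypothesis Gl : bouquet_coordinates l pt.
Hypothesis m2 : 2 <= m.

Let l3 := len_ge3 Gl.
Let evens := [set i | ~~ odd (l i)].
Let fours := [set i | l i == 4].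

(** * Lower bound on the metric dimension *)

Lemma even_two_vertices (W : {set G}) i : oriented l pt W i -> ~ bad l pt W i ->
  ~~ odd (l i) -> exists p r,
  [/\ 0 < p < l i, 0 < r < l i, p <> r, pt i p \in W & pt i r \in W].
Proof.
case=> p [pi pn] pW nb ev; have l3i := l3 i.
(* Take the neighbour [s] of the centre on the half not containing [p]. By evenness it reaches [p]
   through the centre, as it does the centre itself, so the cycle is not bad only thanks to a
   further vertex. *)
have [s [si s1 sp nbs]] : exists s, [/\ 0 < s < l i, cyc (l i) s 0 = 1,
    cyc (l i) s p = (dep (l i) p).+1 & ~ bad_side l pt W i s].
  case: (ltnP p.*2 (l i)) => h; [exists (l i).-1|exists 1].
    by split; try (rewrite /cyc /dep; lia); move=> b; apply: nb; right.
  by split; try (rewrite /cyc /dep; lia); move=> b; apply: nb; left.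
have [r [ri rW rn]] := not_bad_side si nbs.
exists p, r; split=> //; last by move=> e; rewrite -e in rn.
rewrite ri andbT lt0n; apply: contra_notN rn => /eqP->.
by rewrite s1 /dep min0n.
Qed.

Lemma resolving_card (W : {set G}) : resolving W ->
  exists j, m + #|evens :\ j| <= #|W|.
Proof.
move=> rW.
(* The one cycle that may be bad; any index serves if none is. *)
have [j nbj] : exists j, forall i, i != j -> ~ bad l pt W i.
  have [[j bj]|nb] := pselect (exists j, bad l pt W j).
    by exists j => i /eqP ij bi; apply: ij; apply: (resolving_bad Gl rW).
  by exists (Ordinal m2) => i _ bi; apply: nb; exists i.
exists j.
have /choice[w wP] i : exists u : nat * nat,
    [/\ 0 < u.1 < l i, pt i u.1 \in W & i \in evens :\ j ->
        [/\ 0 < u.2 < l i, u.1 <> u.2 & pt i u.2 \in W]].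
  have or := resolving_oriented Gl i rW.
  have [ie|ie] := boolP (i \in evens :\ j); last first.
    by have [p [pi _] pW] := or; exists (p, 0).
  move: ie; rewrite !inE => /andP[/nbj nb ev].
  by have [p [r [pi ri pr pW rW']]] := even_two_vertices or nb ev; exists (p, r).
pose w1 i := pt i (w i).1; pose w2 i := pt i (w i).2.
have c1 : #|w1 @: 'I_m| = m.
  rewrite card_imset ?card_ord // => i i' /(pt_inj Gl).
  by case: (wP i) => ? _ _; case: (wP i') => ? _ _ [].
have c2 : #|w2 @: (evens :\ j)| = #|evens :\ j|.
  apply: card_in_imset => i i' ie ie'.
  case: (wP i) => _ _ /(_ ie)[? _ _]; case: (wP i') => _ _ /(_ ie')[? _ _].
  by case/(pt_inj Gl).
have c12 : w1 @: 'I_m :&: w2 @: (evens :\ j) = set0.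
  apply/eqP; rewrite -subset0; apply/subsetP=> x; rewrite inE => /andP[].
  case/imsetP=> i _ -> /imsetP[i' ie].
  case: (wP i) => pi _ _; case: (wP i') => _ _ /(_ ie)[pi' n _].
  by case/(pt_inj Gl) => // e; subst i'.
rewrite -[X in X + _]c1 -c2 -cardsUI c12 cards0 addn0.
apply/subset_leq_card/subsetP=> x; rewrite inE => /orP[/imsetP[i _ ->]|/imsetP[i ie ->]].
  by case: (wP i).
by case: (wP i) => _ _ /(_ ie)[].
Qed.

(* Resolver needs one vertex of every block: [(i, false)] orients cycle [i], and
   [(i, true)] makes the even cycle [i] not bad.  For the 4-cycle [i1] the latter
   block also contains the antipode of the 4-cycle [i0], one of the two being bad. *)
Definition block (i0 i1 : 'I_m) (t : 'I_m * bool) : {set G} :=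
  let: (i, b) := t in
  let h := (l i)./2 in
  if b then
    if l i == 4 then if i == i1 then [set pt i 2; pt i0 2] else [set pt i 2]
    else [set pt i h.+1; pt i h.+2]
  else if odd (l i) then [set pt i h; pt i h.+1]
  else if l i == 4 then [set pt i 1; pt i 3] else [set pt i 1; pt i 2].

(** Cycle [i0] is allowed to be bad and gets no second block; the count then has the form of the
    bound in [resolving_card]. *)
Definition block_index (i0 : 'I_m) : {set 'I_m * bool} :=
  [set t | t.2 ==> (t.1 \in evens :\ i0)].

Lemma card_block_index i0 : #|block_index i0| = m + #|evens :\ i0|.
Proof.
pose A0 := setX [set: 'I_m] [set false]; pose A1 := setX (evens :\ i0) [set true].
have -> : block_index i0 = A0 :|: A1.
  apply/setP=> -[i []]; rewrite in_setU !in_setX [LHS]inE /= !in_set1 in_setT /=.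
    by rewrite andbT.
  by [].
rewrite cardsU (_ : A0 :&: A1 = set0) ?cards0 ?subn0; last first.
  by apply/setP=> -[i []]; rewrite in_setI !in_setX in_set0 !in_set1 /= ?andbF.
by rewrite !cardsX !cards1 !muln1 cardsT card_ord.
Qed.

(** * Disjoint blocks that Resolver has to hit *)

Section Blocks.
Variables i0 i1 : 'I_m.
Hypothesis i0_four : forall i, l i = 4 -> l i0 = 4.

(** The block is read off from the coordinates of a vertex, which yields disjointness. The antipode
    on [i0] is assigned to cycle [i1], and [2 < p] separates the two blocks of a longer even
    cycle. *)
Let owner k p : 'I_m * bool :=
  if l k == 4 then if p == 2 then (if k == i0 then i1 else k, true) else (k, false)
  else if odd (l k) then (k, false) else (k, 2 < p).

Lemma block_owner t x : t \in block_index i0 -> x \in block i0 i1 t ->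
  exists k p, [/\ x = pt k p, 0 < p < l k & owner k p = t].
Proof.
case: t => i b; rewrite inE /=; have := l3 i => li; rewrite /owner; case: b => /= [|_].
  rewrite !inE => /andP[/negbTE i0i ev]; case: (eqVneq (l i) 4) => [l4|n4].
    case: eqP => [ii|_].
      case/set2P=> ->; [exists i, 2|exists i0, 2].
        by rewrite l4 /= i0i.
      by rewrite (i0_four l4) /= eqxx ii.
    by move/set1P->; exists i, 2; rewrite l4 /= i0i.
  case/set2P=> ->; [exists i, (l i)./2.+1|exists i, (l i)./2.+2];
    rewrite (negbTE n4) (negbTE ev); split=> //; try lia.
    by congr pair; lia.
  by congr pair; lia.
case: (boolP (odd (l i))) => [od|ev].
  have n4 : l i == 4 = false by lia.
  case/set2P=> ->; [exists i, (l i)./2|exists i, (l i)./2.+1]; rewrite n4 od;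
   split=> //; lia.
case: (eqVneq (l i) 4) => [l4|n4]; case/set2P=> ->.
- by exists i, 1; rewrite l4.
- by exists i, 3; rewrite l4.
- by exists i, 1; rewrite (negbTE n4) (negbTE ev); split=> //; lia.
- by exists i, 2; rewrite (negbTE n4) (negbTE ev); split=> //; lia.
Qed.

Lemma block_disjoint t u x : t \in block_index i0 -> u \in block_index i0 ->
  x \in block i0 i1 t -> x \in block i0 i1 u -> t = u.
Proof.
move=> tD uD /(block_owner tD)[k [p [-> kp <-]]] /(block_owner uD)[k' [p' [e kp' <-]]].
by have [-> ->] := pt_inj Gl kp kp' e.
Qed.

Lemma block_nonempty t : block i0 i1 t != set0.
Proof.
case: t => i b; rewrite /block; apply/set0Pn.
case: b; [case: ifP => _; first case: ifP => _|
  case: ifP => _; last case: ifP => _]; eexists; first [exact: set21|exact: set11].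
Qed.

Lemma block_card2 t : t \in block_index i0 ->
  ~~ [&& t.2, l t.1 == 4 & t.1 != i1] -> 2 <= #|block i0 i1 t|.
Proof.
case: t => i b tD /= ok.
have two k k' p p' : 0 < p < l k -> 0 < p' < l k' -> (k, p) != (k', p') ->
    2 <= #|[set pt k p; pt k' p']|.
  move=> pk pk' /eqP ne; rewrite cards2; case: eqP => //= /(pt_inj Gl pk pk')[e e'].
  by case: ne; rewrite e e'.
have := l3 i => li.
case: b tD ok => /=; rewrite inE /=.
  rewrite !inE => /andP[i0i ev] ok; case: (eqVneq (l i) 4) ok => /= [l4|n4 _].
    rewrite negbK => /eqP <-; rewrite eqxx; apply: two; rewrite ?(i0_four l4) ?l4 //.
    by apply: contraNneq i0i => -[->].
  by apply: two; rewrite ?xpair_eqE; lia.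
move=> _ _; case: (boolP (odd (l i))) => [od|ev].
  by apply: two; rewrite ?xpair_eqE; lia.
case: (eqVneq (l i) 4) => [l4|n4].
  by apply: two; rewrite ?l4 // xpair_eqE; lia.
by apply: two; rewrite ?xpair_eqE; lia.
Qed.

(** Orientation comes from the blocks [(i, false)]. Only [i0] and a 4-cycle [i1] can be bad, and if
    they differ their shared block supplies an antipode on one of them. *)
Lemma block_resolving (W : {set G}) :
  (forall t, t \in block_index i0 -> block i0 i1 t :&: W != set0) -> resolving W.
Proof.
move=> hW.
have pick2 p r i k t : t \in block_index i0 -> block i0 i1 t = [set pt i p; pt k r] ->
    pt i p \in W \/ pt k r \in W.
  move=> tD e; have /set0Pn[x] := hW t tD; rewrite e inE => /andP[/set2P[] -> xW];
  by [left|right].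
have F i : (i, false) \in block_index i0 by rewrite inE.
have nbad i : i != i0 -> l i != 4 \/ i != i1 -> ~ bad l pt W i.
  move=> ii0 h; have := l3 i => li.
  case: (boolP (odd (l i))) => od.
    have [|pW|pW] := @pick2 (l i)./2 (l i)./2.+1 i i (i, false) (F i).
    - by rewrite /= od.
    - by apply: (not_bad Gl pW pW); lia.
    - by apply: (not_bad Gl pW pW); lia.
  have tD : (i, true) \in block_index i0 by rewrite !inE /= ii0 od.
  case: (eqVneq (l i) 4) h => [l4|n4] h.
    have ii1 : i != i1 by case: h.
    have /set0Pn[x] := hW _ tD; rewrite inE => /andP[].
    rewrite /block l4 /= (negbTE ii1) => /set1P-> pW.
    by apply: (not_bad Gl pW pW); rewrite l4.
  have [|pW|pW] := @pick2 (l i)./2.+1 (l i)./2.+2 i i (i, true) tD;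
    [by rewrite /= (negbTE n4)| |];
  (* For even length at least 6 the two blocks lie in opposite open halves, so one vertex of each
     suffices. *)
  have [|rW|rW] := @pick2 1 2 i i (i, false) (F i);
    by [rewrite /= (negbTE n4) (negbTE od)|apply: (not_bad Gl pW rW); lia].
apply: (oriented_resolving Gl m2) => [i|].
  have := l3 i => li; case: (boolP (odd (l i))) => od.
    have [|pW|pW] := @pick2 (l i)./2 (l i)./2.+1 i i (i, false) (F i).
    - by rewrite /= od.
    - by exists (l i)./2 => //; split; lia.
    - by exists (l i)./2.+1 => //; split; lia.
  case: (eqVneq (l i) 4) => [l4|n4].
    have [|pW|pW] := @pick2 1 3 i i (i, false) (F i).
    - by rewrite /= l4.
    - by exists 1; rewrite ?l4.
    - by exists 3; rewrite ?l4.
  have [|pW|pW] := @pick2 1 2 i i (i, false) (F i).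
  - by rewrite /= (negbTE od) (negbTE n4).
  - by exists 1 => //; split; lia.
  - by exists 2 => //; split; lia.
have bad01 i : bad l pt W i -> i = i0 \/ i = i1.
  move=> bi; case: (eqVneq i i0) => [|n0]; first by left.
  case: (eqVneq i i1) => [|n1]; first by right.
  by case: (nbad i n0) => //; right.
have not01 : i1 != i0 -> bad l pt W i0 -> bad l pt W i1 -> False.
  move=> n10 b0 b1; case: (eqVneq (l i1) 4) => [l4|n4]; last by apply: (nbad i1) => //; left.
  have tD : (i1, true) \in block_index i0 by rewrite !inE /= n10 l4.
  have [|pW|pW] := @pick2 2 2 i1 i0 (i1, true) tD.
  - by rewrite /= l4 /= eqxx.
  - by apply: (not_bad Gl pW pW _ _ _ _ b1); rewrite l4.
  - by apply: (not_bad Gl pW pW _ _ _ _ b0); rewrite (i0_four l4).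
move=> i j bi bj; case: (eqVneq i1 i0) => [e|n10].
  by case: (bad01 i bi) => ->; case: (bad01 j bj) => ->.
by case: (bad01 i bi) (bad01 j bj) => ei [] ej; subst i j => //; case: not01.
Qed.

End Blocks.

(** Preferring a 4-cycle, then an even cycle, for [i0] minimises the number of blocks. Another
    4-cycle as [i1], if there is one, leaves at most [#|fours| - 2] singleton blocks. *)
Lemma choose_i0_i1 : exists i0 i1, [/\ forall i, l i = 4 -> l i0 = 4,
    forall i, ~~ odd (l i) -> ~~ odd (l i0)
  & #|[set i in fours | (i != i0) && (i != i1)]| <= #|fours| - 2].
Proof.
have [i0 [h4 he]] : exists i0, (forall i, l i = 4 -> l i0 = 4) /\
    (forall i, ~~ odd (l i) -> ~~ odd (l i0)).
  case: (pickP (fun i => l i == 4)) => [i0 /eqP l4|n4].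
    by exists i0; split=> // i _; rewrite l4.
  case: (pickP (fun i => ~~ odd (l i))) => [i0 ev|ne].
    by exists i0; split=> // i /eqP; rewrite n4.
  by exists (Ordinal m2); split=> i h; [have := n4 i; rewrite h|have := ne i; rewrite h].
case: (pickP (fun i => (i \in fours) && (i != i0))) => [i1 /andP[i1f i10]|none].
  exists i0, i1; split=> //.
  have -> : [set i in fours | (i != i0) && (i != i1)] = fours :\ i0 :\ i1.
    by apply/setP=> i; rewrite !inE; do !case: (_ == _).
  have i0f : i0 \in fours by move: i1f; rewrite !inE => /eqP/h4->.
  have := cardsD1 i0 fours; have := cardsD1 i1 (fours :\ i0).
  by rewrite i0f in_setD1 i10 i1f /=; lia.
exists i0, i0; split=> //; rewrite (_ : [set i in _ | _] = set0) ?cards0 //.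
by apply/setP=> i; rewrite inE in_set0; have := none i; case: (i \in fours); case: (i != i0).
Qed.

Lemma setT_resolving : resolving [set: G].
Proof.
apply: (oriented_resolving Gl m2) => [i|i j bi].
  by exists 1; rewrite ?in_setT //; have := l3 i; lia.
by case: (@not_bad _ _ _ _ Gl setT i (l i).-1 1 _ _ _ _ _ _ bi); rewrite ?in_setT //; have := l3 i; lia.
Qed.

Lemma resolver_wins f : #|fours| <= 3 -> (f = Spoiler -> #|fours| <= 2) ->
  wins_within G f Resolver (metric_dim G).
Proof.
move=> z3 z2; have [i0 [i1 [h4 he c]]] := choose_i0_i1.
apply: (@wins_within_leq _ _ _ #|block_index i0|).
  have [W rW ->] := metric_dimP setT_resolving.
  have [j cj] := resolving_card rW; rewrite card_block_index; apply: leq_trans cj.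
  (* Since [i0] is even as soon as some cycle is, removing it from [evens] leaves no more than
     removing any [j]. *)
  rewrite leq_add2l; have := cardsD1 i0 evens; have := cardsD1 j evens.
  have [i0e|] := boolP (i0 \in evens).
    by case: (j \in evens) => /=; lia.
  rewrite inE => /negbNE o0; have -> : evens = set0; last by rewrite !set0D.
  by apply/setP=> i; rewrite !inE; apply/negbTE/negP=> /he; rewrite o0.
pose bads := [set i in fours | (i != i0) && (i != i1)].
have badP (t : 'I_m * bool) : t \in block_index i0 -> [&& t.2, l t.1 == 4 & t.1 != i1] ->
    t = (t.1, true) /\ t.1 \in bads.
  case: t => i []; rewrite !inE //= => /andP[-> _] /andP[-> ->]; by [].
apply: (@pairing_wins _ _ _ (block i0 i1) _ (pt i0 0)).
- by move=> t u x; apply: block_disjoint.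
- by move=> t _; apply: block_nonempty.
- move=> t u tD uD tu.
  have [bt|/(block_card2 h4 tD)] := boolP [&& t.2, l t.1 == 4 & t.1 != i1]; last by left.
  have [bu|/(block_card2 h4 uD)] := boolP [&& u.2, l u.1 == 4 & u.1 != i1]; last by right.
  have [et tb] := badP t tD bt; have [eu ub] := badP u uD bu.
  have /card_le1_eqP/(_ _ _ tb ub) e : #|bads| <= 1 by apply: leq_trans c _; lia.
  by case/eqP: tu; rewrite et eu e.
- move=> fS t tD; apply: (block_card2 h4 tD); apply/negP=> bt.
  have [_ tb] := badP t tD bt.
  have /eqP : #|bads| == 0 by rewrite -leqn0; apply: leq_trans c _; have := z2 fS; lia.
  by move/cards0_eq => e; rewrite e inE in tb.
- by move=> W; apply: block_resolving.
Qed.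

(** Resolver pairs the two neighbours of the centre on each cycle, so the vertices not taken by
    Spoiler always orient every cycle. Spoiler must then create two bad cycles, at a cost of two
    vertices each. *)
Lemma spoiler_needs4 f k : wins_within G f Spoiler k -> 4 <= k.
Proof.
case=> s2 ls2 H2.
pose B i := [set pt i 1; pt i (l i).-1].
have B2 i : 2 <= #|B i|.
  rewrite cards2; case: eqP => // /(pt_inj Gl)[]; have := l3 i; lia.
have Bd t u x : t \in [set: 'I_m] -> u \in [set: 'I_m] -> x \in B t -> x \in B u -> t = u.
  have B1 i y : y \in B i -> exists2 p, y = pt i p & 0 < p < l i.
    by have := l3 i => li /set2P[]->; [exists 1|exists (l i).-1] => //; lia.
  by move=> _ _ /B1[p -> tp] /B1[r /(pt_inj Gl tp)] h ur; case: (h ur).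
have Bn i : i \in [set: 'I_m] -> B i != set0.
  by rewrite -card_gt0 => _; apply: leq_trans (B2 i).
have [||s1 ls1 H1] := @pairing_strategy G _ [set: 'I_m] B Bd Bn f (pt (Ordinal m2) 0).
- by left.
- by [].
have [h [[uh sh] F1 F2]] := play_exists f ls1 ls2.
have [h1 [p1 c1 w1]] := H2 h (conj uh sh) F2.
have {H1} [H1 _] := H1 h1 (prefix_uniq p1 uh) (follows_prefix p1 F1).
rewrite leqNgt; apply/negP=> k4; move/negP: w1; apply.
set S := claimed _ _ h1 in c1 H1 *.
apply: (oriented_resolving Gl m2) => [i|i j bi bj].
  have := l3 i => li; have /subsetPn[x] := H1 i (in_setT i).
  by case/set2P=> -> xS; [exists 1|exists (l i).-1]; rewrite ?in_setC //; split; lia.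
have two k' : bad l pt (~: S) k' -> exists p r,
    [/\ 0 < p < l k', 0 < r < l k', p <> r, pt k' p \in S & pt k' r \in S].
  have := l3 k' => lk; have inS s p : p < l k' -> bad_side l pt (~: S) k' s ->
      cyc (l k') s p <> (dep (l k') p).+1 -> pt k' p \in S.
    by move=> pk b; apply: contra_notT => pS; apply: b; rewrite ?in_setC.
  (* The bad neighbour of the centre and the next vertex away from the centre are both reached
     without passing through the centre. *)
  case=> b; [exists 1, 2|exists (l k').-1, (l k').-2]; split; try lia;
    by apply: inS b _; rewrite /cyc /dep; lia.
apply: contrapT => ij.
have [p [r [pi ri pr pS rS]]] := two i bi; have [p' [r' [pj rj pr' pS' rS']]] := two j bj.
have : #|[set pt i p; pt i r] :|: [set pt j p'; pt j r']| <= #|S|.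
  by apply: subset_leq_card; rewrite !subUset !sub1set pS rS pS' rS'.
have -> : #|[set pt i p; pt i r] :|: [set pt j p'; pt j r']| = 4; last by lia.
rewrite cardsU !cards2 (_ : _ :&: _ = set0) ?cards0.
  case: eqP => [/(pt_inj Gl pi ri)[]//|_]; case: eqP => [/(pt_inj Gl pj rj)[]//|_].
  by [].
apply/setP=> x; rewrite in_setI in_set0; apply/negbTE/negP=> /andP[].
by move=> /set2P[]-> /set2P[] /(pt_inj Gl)[].
Qed.

(** * Spoiler's attack on the 4-cycles *)

Lemma won_opposite f (h : seq G) c : l c = 4 -> pt c 1 \in claimed f Spoiler h ->
  pt c 3 \in claimed f Spoiler h -> has_won f Spoiler h.
Proof.
(* Positions 1 and 3 are the only ones on a 4-cycle that could orient it. *)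
move=> l4 c1 c3; apply/negP=> /(resolving_oriented Gl c)[p]; rewrite l4 => -[p4 p2].
have /orP[] : (p == 1) || (p == 3) by lia.
  by move/eqP->; rewrite in_setC c1.
by move/eqP->; rewrite in_setC c3.
Qed.

Lemma won_two_bad f (h : seq G) a c : l a = 4 -> l c = 4 -> a <> c ->
  pt a 1 \in claimed f Spoiler h -> pt a 2 \in claimed f Spoiler h ->
  pt c 1 \in claimed f Spoiler h -> pt c 2 \in claimed f Spoiler h ->
  has_won f Spoiler h.
Proof.
move=> la lc ac a1 a2 c1 c2; apply/negP=> rW.
have bd k : l k = 4 -> pt k 1 \in claimed f Spoiler h ->
    pt k 2 \in claimed f Spoiler h -> bad l pt (~: claimed f Spoiler h) k.
  (* The remaining positions 0 and 3 are both reached from 1 through the centre. *)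
  move=> lk k1 k2; left=> p; rewrite lk => p4; rewrite in_setC.
  by case: p p4 => [|[|[|[|]]]] //; rewrite ?k1 ?k2.
by apply: ac; apply: (resolving_bad Gl rW); apply: bd.
Qed.

Definition untouched (h : seq G) c := forall p, 0 < p < 4 -> pt c p \notin h.

(* Spoiler plays [pt c 1]; unless Resolver answers [pt c 3], Spoiler takes it. *)
Lemma spoiler_opens f k (h : seq G) c : l c = 4 -> has_turn f Spoiler (size h) ->
  untouched h c ->
  wins_from f Spoiler k.+1 (rcons (rcons h (pt c 1)) (pt c 3)) ->
  wins_from f Spoiler k.+2 h.
Proof.
move=> l4 tr uc w.
have ne p r : 0 < p < 4 -> 0 < r < 4 -> p <> r -> (pt c p == pt c r) = false.
  by move=> pc rc pr; apply/eqP=> /(pt_inj Gl); rewrite l4 => -[].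
apply: (@wins_move _ _ _ _ _ (pt c 1)) => //; first exact: uc.
apply: (@wins_reply _ _ _ _ _ (pt c 3)).
- by rewrite size_rcons has_turnS tr.
- by rewrite mem_rcons inE ne // uc.
move=> x xh; have [-> //|x3] := eqVneq x (pt c 3).
have c3h : pt c 3 \notin rcons (rcons h (pt c 1)) x.
  by rewrite !(mem_rcons, inE) (eq_sym _ x) (negbTE x3) ne // (negbTE (uc 3 _)).
have tr2 : has_turn f Spoiler (size (rcons (rcons h (pt c 1)) x)).
  by rewrite !size_rcons !has_turnS tr.
apply: (@wins_move _ _ _ _ _ (pt c 3)) => //.
apply: wins_now; apply: (@won_opposite _ _ c l4).
  rewrite claimed_rcons // tr2 claimed_rcons // size_rcons has_turnS tr /=.
  by rewrite claimed_rcons ?uc // tr !in_setU1 eqxx orbT.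
by rewrite claimed_rcons // tr2 in_setU1 eqxx.
Qed.

Lemma spoiler_second f (h : seq G) a c : l a = 4 -> l c = 4 -> a <> c ->
  has_turn f Spoiler (size h) -> untouched h c ->
  pt a 1 \in claimed f Spoiler h -> pt a 2 \in claimed f Spoiler h ->
  wins_from f Spoiler 2 h.
Proof.
move=> la lc ac tr uc a1 a2.
have ne p r : 0 < p < 4 -> 0 < r < 4 -> p <> r -> (pt c p == pt c r) = false.
  by move=> pc rc pr; apply/eqP=> /(pt_inj Gl); rewrite lc => -[].
apply: (spoiler_opens lc tr uc).
set h' := rcons (rcons h _) _.
have c2h : pt c 2 \notin h' by rewrite !(mem_rcons, inE) !ne // (negbTE (uc 2 _)).
have tr' : has_turn f Spoiler (size h') by rewrite !size_rcons !has_turnS tr.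
apply: (@wins_move _ _ _ _ _ (pt c 2)) => //; apply: wins_now.
have c3h : pt c 3 \notin rcons h (pt c 1) by rewrite mem_rcons inE ne // uc.
have e : claimed f Spoiler (rcons h' (pt c 2)) =
    pt c 2 |: (pt c 1 |: claimed f Spoiler h).
  rewrite claimed_rcons // tr' claimed_rcons // size_rcons has_turnS tr /=.
  by rewrite claimed_rcons ?uc // tr.
by apply: (@won_two_bad _ _ a c); rewrite ?e // !in_setU1 ?a1 ?a2 ?eqxx ?orbT.
Qed.

(** Resolver's only free reply comes after [pt a 2], and it cannot touch both [b] and [c]. Two moves
    in [a] and two in the cycle left untouched make four. *)
Lemma spoiler_three f (h : seq G) a b c : l a = 4 -> l b = 4 -> l c = 4 ->
  a <> b -> a <> c -> b <> c -> has_turn f Spoiler (size h) ->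
  untouched h a -> untouched h b -> untouched h c -> wins_from f Spoiler 4 h.
Proof.
move=> la lb lc ab ac bc tr ua ub uc.
have ne p r k k' : l k = 4 -> l k' = 4 -> 0 < p < 4 -> 0 < r < 4 ->
    k <> k' \/ p <> r -> (pt k p == pt k' r) = false.
  by move=> lk lk' pk rk pr; apply/eqP=> /(pt_inj Gl); rewrite lk lk' => -[] //; case: pr.
apply: (spoiler_opens la tr ua).
set h1 := rcons (rcons h _) _.
have a3 : pt a 3 \notin rcons h (pt a 1) by rewrite mem_rcons inE ne ?ua //; right.
have a2 : pt a 2 \notin h1 by rewrite !(mem_rcons, inE) !ne ?(negbTE (ua 2 _)) //; right.
have tr1 : has_turn f Spoiler (size h1) by rewrite !size_rcons !has_turnS tr.
apply: (@wins_move _ _ _ _ _ (pt a 2)) => //.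
set h2 := rcons h1 _.
have tr2 : has_turn f Spoiler (size h2) = false by rewrite size_rcons has_turnS tr1.
have unt k : l k = 4 -> a <> k -> untouched h k -> untouched h2 k.
  move=> lk ak uk p p4; rewrite !(mem_rcons, inE) !(ne p _ k a) //; try by left; apply: nesym.
  by rewrite (negbTE (uk p p4)).
have claimed2 x : x \notin h2 ->
    claimed f Spoiler (rcons h2 x) = pt a 2 |: (pt a 1 |: claimed f Spoiler h).
  move=> xh; rewrite claimed_rcons // tr2 claimed_rcons // tr1 claimed_rcons //.
  by rewrite size_rcons has_turnS tr /= claimed_rcons ?ua // tr.
apply: (@wins_reply _ _ _ _ _ (pt b 1)); first by rewrite tr2.
  exact: unt.
move=> x xh.
have [k [ak lk uk]] : exists k, [/\ a <> k, l k = 4 & untouched (rcons h2 x) k].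
  have [[p p4 xp]|nx] := pselect (exists2 p, 0 < p < 4 & x = pt b p).
    exists c; split=> // r r4; rewrite mem_rcons inE xp ne //=; last by left; apply: nesym.
    exact: unt.
  exists b; split=> // r r4; rewrite mem_rcons inE negb_or unt // andbT.
  by apply/eqP=> e; apply: nx; exists r.
apply: (@spoiler_second _ _ a k) => //.
- by rewrite size_rcons has_turnS tr2.
- by rewrite claimed2 // !in_setU1 eqxx orbT.
- by rewrite claimed2 // !in_setU1 eqxx.
Qed.

Lemma three_fours (A : {set 'I_m}) : 3 <= #|A| -> exists a b c,
  [/\ a \in A, b \in A, c \in A & [/\ a <> b, a <> c & b <> c]].
Proof.
move=> A3; have /card_gt0P[a aA] : 0 < #|A| by lia.
have /card_gt0P[b] : 0 < #|A :\ a| by have := cardsD1 a A; rewrite aA; lia.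
move=> bA; have /card_gt0P[c] : 0 < #|A :\ a :\ b|.
  by have := cardsD1 b (A :\ a); have := cardsD1 a A; rewrite aA bA; lia.
move: bA; rewrite !inE => /andP[/eqP ba bA] /and3P[/eqP cb /eqP ca cA].
by exists a, b, c; split=> //; split; apply: nesym.
Qed.

Lemma spoiler_wins f : 3 <= #|fours| -> (f = Resolver -> 4 <= #|fours|) ->
  wins_within G f Spoiler 4.
Proof.
move=> z3 z4; have x0 := pt (Ordinal m2) 0; apply: (wins_from_within x0).
case: f z4 => [/(_ erefl) z4|_]; last first.
  have [a [b [c [+ + + [ab ac bc]]]]] := three_fours z3; rewrite !inE.
  by move=> /eqP la /eqP lb /eqP lc; apply: (@spoiler_three _ _ a b c).
apply: (@wins_reply _ _ _ _ _ x0) => // x _.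
(* Resolver's opening move touches at most one cycle away from the centre, so three of the four
   4-cycles stay untouched. *)
have [k uk] : exists k, forall i, i <> k -> l i = 4 -> untouched (rcons [::] x) i.
  have [k [p [pk ->]]] := pt_surj Gl x; exists k => i ik li r r4; rewrite inE.
  by apply/eqP=> /(pt_eq Gl)[||[]|[]]; rewrite ?li //; lia.
have [a [b [c [+ + + [ab ac bc]]]]] : exists a b c, [/\ a \in fours :\ k, b \in fours :\ k,
    c \in fours :\ k & [/\ a <> b, a <> c & b <> c]].
  apply: three_fours; rewrite -ltnS; apply: leq_trans z4 _.
  by rewrite (cardsD1 k); apply: leq_add (leq_b1 _) (leqnn _).
rewrite !inE => /andP[/eqP ak /eqP la] /andP[/eqP bk /eqP lb] /andP[/eqP ck /eqP lc].
by apply: (@spoiler_three _ _ a b c) => //; apply: uk.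
Qed.

End BouquetGames.

Theorem theorem4p10 (G : sgraph) (m z : nat) (l : 'I_m -> nat)
    (hm : 2 <= m) (hG : is_bouquet l G) (hz : #|[set i | l i == 4]| = z) :
  [/\ z <= 2 -> has_outcome G outcome_R,
      z = 3 -> has_outcome G outcome_N,
      4 <= z -> has_outcome G outcome_S,
      has_outcome G outcome_R ->
        R_MB G = Some (metric_dim G) /\ R'_MB G = Some (metric_dim G)
    & has_outcome G outcome_S -> S_MB G = Some 4 /\ S'_MB G = Some 4].
Proof.
have [pt Gl] := bouquet_has_coordinates hG.
have RR : z <= 3 -> wins_within G Resolver Resolver (metric_dim G).
  by move=> z3; apply: (resolver_wins Gl) => //; rewrite hz.
have SR : z <= 2 -> wins_within G Spoiler Resolver (metric_dim G).
  by move=> z2; apply: (resolver_wins Gl); rewrite // hz //; lia.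
have RS : 4 <= z -> wins_within G Resolver Spoiler 4.
  by move=> z4; apply: (spoiler_wins Gl); rewrite // hz //; lia.
have SS : 3 <= z -> wins_within G Spoiler Spoiler 4.
  by move=> z3; apply: (spoiler_wins Gl); rewrite // hz.
have win := wins_within_winning.
split.
- by move=> z2; split; apply: win; [apply: RR; lia|apply: SR].
- by move=> z3; split; apply: win; [apply: RR; lia|apply: SS; lia].
- by move=> z4; split; apply: win; [apply: RS|apply: SS; lia].
(* The outcome determines the range of [z], because both players cannot have winning strategies in
   the same game. *)
- case=> _ wR; have z2 : z <= 2.
    by rewrite leqNgt; apply/negP=> z3; apply: winning_exclusive wR (win _ _ _ _ (SS z3)).
  by split; apply: min_moves_eq; do ?[exact: resolver_lower_bound|apply: RR; lia|exact: SR].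
- case=> wS _; have z4 : 4 <= z.
    by rewrite leqNgt; apply/negP=> z3; apply: winning_exclusive (win _ _ _ _ (RR z3)) wS.
  by split; apply: min_moves_eq; do ?[exact: (spoiler_needs4 Gl)|exact: RS|apply: SS; lia].
Qed.
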